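(* Let $r\geq 3$ be odd. If $G$ is an $r$-regular graph on $n$ vertices, then \[\bar{\kappa}_{\max}(G)\le \frac{r-1}{2}+\frac{n}{4(n-1)}.\]
   Context: All graphs are finite, loopless, without multiple edges. An orientation of a graph $G$ is a digraph obtained by assigning a direction to every edge of $G$. For a digraph $D$ and distinct vertices $u,v$, $\kappa_D(u,v)$ is the maximum number of internally disjoint directed $u$--$v$ paths in $D$. The average connectivity of a digraph $D$ of order $n$ is $\bar{\kappa}(D)=\frac{1}{n(n-1)}\sum_{(u,v)}\kappa_D(u,v)$, summed over all ordered pairs of distinct vertices. For a graph $G$, $\bar{\kappa}_{\max}(G)$ is the maximum of $\bar{\kappa}(D)$ over all orientations $D$ of $G$. *)

(* Defs.v *)
From HB Require Import structures.
From mathcomp Require Import all_boot all_order all_algebra.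

Set Implicit Arguments.
Unset Strict Implicit.
Unset Printing Implicit Defensive.

Import Order.TTheory GRing.Theory Num.Theory.

Record sgraph := SGraph {
  svertex :> finType;
  sedge : rel svertex;
  sedge_sym : symmetric sedge;
  sedge_irrefl : irreflexive sedge }.

Definition regular (r : nat) (G : sgraph) : Prop :=
  forall x : G, #|[set y | sedge x y]| = r.

(* A digraph on the vertex type V is given by its set of arcs. *)
Definition darc (V : finType) (D : {set V * V}) : rel V :=
  fun x y => (x, y) \in D.

Definition orientation (G : sgraph) (D : {set G * G}) : bool :=
  [forall x, forall y,
    (sedge x y == (darc D x y || darc D y x)) && ~~ (darc D x y && darc D y x)].

Section Connectivity.

Variables (V : finType) (D : {set V * V}).

(* A path is represented by the sequence of all its vertices, ends included. *)
Definition dipath (u v : V) (s : seq V) : bool :=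
  if s is x :: p then
    [&& x == u, last x p == v, path (darc D) x p & uniq (x :: p)]
  else false.

Definition internal (u v : V) (s : seq V) : seq V :=
  [seq x <- s | (x != u) && (x != v)].

(* Paths repeat no vertex, so the length bound #|V| loses none of them. *)
Definition disjoint_dipaths (u v : V) (P : {set {bseq #|V| of V}}) : bool :=
  [forall p in P, dipath u v p] &&
  [forall p in P, forall q in P,
    (p != q) ==> [disjoint internal u v p & internal u v q]].

Definition kappa (u v : V) : nat :=
  \max_(P : {set {bseq #|V| of V}} | disjoint_dipaths u v P) #|P|.

Definition avg_kappa : rat :=
  ((\sum_(u : V) \sum_(v : V | v != u) kappa u v)%N%:R
     / (#|V| * #|V|.-1)%N%:R)%R.

End Connectivity.

(* Every graph has an orientation and avg_kappa is nonnegative, so the neutral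
   element 0 does not affect the maximum. *)
Definition kappa_max (G : sgraph) : rat :=
  \big[Num.max/0%R]_(D : {set G * G} | orientation D) avg_kappa D.

(* Main.v *)
Require Import Defs.
From HB Require Import structures.
From mathcomp Require Import all_boot all_order all_algebra.
From mathcomp Require Import zify ring lra.

Set Implicit Arguments.
Unset Strict Implicit.
Unset Printing Implicit Defensive.

Import Order.TTheory GRing.Theory Num.Theory.
Local Open Scope ring_scope.

(** Internally disjoint [u]-[v] paths leave [u] and enter [v] through distinct
    arcs, so [kappa u v <= min (d+ u) (d- v)].  Write [r = 2k + 1] and call a
    vertex rich when its outdegree exceeds [k].  As [d+ w + d- w = r], adding
    the bounds for [(u, v)] and [(v, u)] gives at most [2k], or [2k + 1] when
    exactly one of [u], [v] is rich.  With [a] rich vertices there are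
    [a (n - a) <= n^2 / 4] pairs of the latter kind. *)

Definition out_nbrs (V : finType) (D : {set V * V}) (x : V) : {set V} :=
  [set y | darc D x y].

Definition in_nbrs (V : finType) (D : {set V * V}) (x : V) : {set V} :=
  [set y | darc D y x].

Definition reverse (V : finType) (D : {set V * V}) : {set V * V} :=
  [set a | (a.2, a.1) \in D].

Section Paths.

Variable V : finType.
Implicit Types (D : {set V * V}) (u v : V) (s t : seq V).

Lemma dipath_rev D u v s : dipath D u v s -> dipath (reverse D) v u (rev s).
Proof.
case: s => // x p /and4P[/eqP xu /eqP lv pth un]; subst u v.
rewrite lastI rev_rcons /=; apply/and4P; split=> //.
- by case: p {pth un} => //= y p; rewrite rev_cons last_rcons.
- rewrite rev_path.
  by apply: sub_path pth => y z; rewrite /darc inE.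
- by rewrite -[_ && _]/(uniq (_ :: _)) -rev_rcons -lastI rev_uniq.
Qed.

Lemma internal_rev u v s : internal v u (rev s) = rev (internal u v s).
Proof.
by rewrite /internal filter_rev; congr rev; apply: eq_filter => x; rewrite andbC.
Qed.

(** As [v != u] rules out the one-vertex path, index 1 is in range and the default [u] of [nth] is
    never returned. *)
Lemma dipath_second D u v s : v != u -> dipath D u v s ->
  darc D u (nth u s 1).
Proof.
move=> vu; case: s => // x [|y p] /and4P[/eqP-> /=]; last by move=> _ /andP[].
by rewrite eq_sym (negPf vu).
Qed.

(** A shared second vertex other than [v] would be internal to both paths, against disjointness. So
    it is [v], and both paths are the single arc from [u] to [v]. *)
Lemma dipath_second_inj D u v s t : v != u ->
  dipath D u v s -> dipath D u v t ->
  [disjoint internal u v s & internal u v t] ->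
  nth u s 1 = nth u t 1 -> s = t.
Proof.
move=> vu; case: s => // x [|y p] /and4P[/eqP-> /=].
  by rewrite eq_sym (negPf vu).
move=> ly _ /and3P[]; rewrite inE negb_or => /andP[uy _] yp up.
case: t => // x' [|z q] /and4P[/eqP-> /=].
  by rewrite eq_sym (negPf vu).
move=> lz _ /and3P[_ zq uq] dis yz; subst z.
have [yv|yv] := eqVneq y v; last first.
  have y_int w : y \in internal u v [:: u, y & w].
    by rewrite mem_filter yv eq_sym uy !inE eqxx orbT.
  by have := disjointFr dis (y_int p); rewrite y_int.
(* Here [y = v] also ends the path, so any further vertex would force a repetition of [v]. *)
have nilP w : last y w == v -> y \notin w -> w = [::].
  case: w => // c w /eqP /= l; rewrite yv -l => /negP[]; exact: mem_last.
by rewrite (nilP p) // (nilP q).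
Qed.

Lemma kappa_le_out D u v : v != u -> (kappa D u v <= #|out_nbrs D u|)%N.
Proof.
move=> vu; apply/bigmax_leqP => P /andP[/forall_inP dp /forall_inP dis].
rewrite -(@card_in_imset _ _ (fun p : {bseq #|V| of V} => nth u p 1)).
  apply/subset_leq_card/subsetP => _ /imsetP[p /dp pP ->].
  by rewrite inE (dipath_second vu pP).
move=> p q pP qP e; apply/eqP; apply: contraT => pq.
have /forall_inP/(_ q qP)/implyP/(_ pq) d := dis p pP.
by case/eqP: pq; apply/val_inj/(dipath_second_inj vu (dp _ pP) (dp _ qP)).
Qed.

(** Reversing all paths turns the penultimate vertex into the second one, which reduces this to the
    argument for outdegrees. *)
Lemma kappa_le_in D u v : v != u -> (kappa D u v <= #|in_nbrs D v|)%N.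
Proof.
rewrite eq_sym => uv; apply/bigmax_leqP => P /andP[/forall_inP dp /forall_inP dis].
rewrite -(@card_in_imset _ _ (fun p : {bseq #|V| of V} => nth v (rev p) 1)).
  apply/subset_leq_card/subsetP => _ /imsetP[p /dp/dipath_rev pP ->].
  by have := dipath_second uv pP; rewrite /darc !inE.
move=> p q pP qP e; apply/eqP; apply: contraT => pq.
have /forall_inP/(_ q qP)/implyP/(_ pq) d := dis p pP.
case/eqP: pq; apply/val_inj/(can_inj revK).
apply: (dipath_second_inj uv (dipath_rev (dp _ pP)) (dipath_rev (dp _ qP))) e.
by rewrite !internal_rev (eq_disjoint (mem_rev _)) (eq_disjoint_r (mem_rev _)).
Qed.

End Paths.

Lemma sum_symmetrize (V : finType) (f : V -> V -> nat) :
  (\sum_u \sum_(v | v != u) (f u v + f v u) =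
   (\sum_u \sum_(v | v != u) f u v).*2)%N.
Proof.
under eq_bigr do rewrite big_split.
rewrite big_split /= -addnn; congr addn.
rewrite (exchange_big_dep predT) //=.
by apply: eq_bigr => v _; apply: eq_bigl => u; rewrite eq_sym.
Qed.

Lemma sum_cut_pairs (V : finType) (A : {set V}) :
  (\sum_u \sum_v ((u \in A) != (v \in A)) = (#|A| * #|~: A|).*2)%N.
Proof.
rewrite (bigID (mem A)) /= -addnn; congr addn.
  rewrite -sum_nat_const; apply: eq_bigr => u ->.
  rewrite -sum1_card [RHS]big_mkcond; apply: eq_bigr => v _.
  by rewrite inE; case: (v \in A).
rewrite mulnC -sum_nat_const.
under [RHS]eq_bigl do rewrite inE.
apply: eq_bigr => u /negPf->.
rewrite -sum1_card [RHS]big_mkcond; apply: eq_bigr => v _.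
by case: (v \in A).
Qed.

Lemma orientation_degree (G : sgraph) (D : {set G * G}) (x : G) :
  orientation D ->
  (#|out_nbrs D x| + #|in_nbrs D x| = #|[set y | sedge x y]|)%N.
Proof.
move=> /forallP/(_ x)/forallP oD.
have -> : [set y | sedge x y] = out_nbrs D x :|: in_nbrs D x.
  by apply/setP => y; rewrite !inE; case/andP: (oD y) => /eqP.
rewrite cardsU; have -> : out_nbrs D x :&: in_nbrs D x = set0.
  by apply/setP => y; rewrite !inE; case/andP: (oD y) => _ /negPf.
by rewrite cards0 subn0.
Qed.

(** The factor 4 clears the denominator of [n^2 / 4], keeping the count in [nat]. *)
Lemma sum_kappa_le (k : nat) (G : sgraph) (D : {set G * G}) :
  regular k.*2.+1 G -> orientation D ->
  (4 * (\sum_(u : G) \sum_(v : G | v != u) kappa D u v)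
     <= 4 * k * (#|G| * #|G|.-1) + #|G| ^ 2)%N.
Proof.
move=> reg oD; set S := (\sum_u _)%N.
pose A := [set x : G | (k < #|out_nbrs D x|)%N].
have pair_le u v : v != u ->
    (kappa D u v + kappa D v u <= k.*2 + ((u \in A) != (v \in A)))%N.
  move=> vu; rewrite !inE.
  have := orientation_degree u oD; have := orientation_degree v oD.
  rewrite !reg; have := kappa_le_out D vu; have := kappa_le_in D vu.
  have uv : u != v by rewrite eq_sym.
  have := kappa_le_out D uv; have := kappa_le_in D uv.
  (* Two rich vertices: both indegrees are at most [k]. Two others: both outdegrees are. Mixed: the
     out- and indegree of [u] bound the two terms and add up to [2k + 1]. *)
  by do 2 case: ltnP; rewrite /=; lia.
have : (S.*2 <= k.*2 * (#|G| * #|G|.-1) + (#|A| * #|~: A|).*2)%N.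
  rewrite -sum_symmetrize -sum_cut_pairs.
  have -> : (k.*2 * (#|G| * #|G|.-1) = \sum_(u : G) \sum_(v | v != u) k.*2)%N.
    under eq_bigr => u _ do rewrite sum_nat_const cardC1.
    by rewrite sum_nat_const mulnC -mulnA.
  rewrite -big_split; apply: leq_sum => u _ /=.
  apply: (@leq_trans (\sum_(v | v != u) (k.*2 + ((u \in A) != (v \in A))))%N).
    by apply: leq_sum => v /pair_le.
  (* The cut sum also ranges over the diagonal, which can only enlarge it. *)
  rewrite big_split leq_add2l [leqRHS](bigID (fun v => v != u)).
  exact: leq_addr.
have [+ _] := nat_AGM2 #|A| #|~: A|; rewrite cardsC.
move: (_ * #|~: A|)%N (#|G| * _)%N (#|G| ^ 2)%N => ab m q; nia.
Qed.

Theorem theorem3p2 (r n : nat) (hr : (3 <= r)%N) (hodd : odd r)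
    (G : sgraph) (hn : #|G| = n) (hreg : regular r G) :
  kappa_max G <= (r%:R - 1) / 2 + n%:R / (4 * (n%:R - 1)).
Proof.
have [k rE] : exists k, r = k.*2.+1.
  by exists r./2; rewrite -[LHS]odd_double_half hodd.
have -> : (r%:R - 1) / 2 = k%:R :> rat.
  by rewrite rE -addn1 natrD -mul2n natrM; field.
(* A vertex has [r >= 3] neighbours, so [n = 1] cannot occur and [n - 1] vanishes in neither
   case. *)
have n_cases : n = 0 \/ (1 < n)%N.
  have [G0|/card_gt0P[x _]] := posnP #|G|; first by left; rewrite -hn.
  right; rewrite -hn; have := max_card [set y | sedge x y].
  by rewrite hreg; lia.
(* Needed for the neutral element 0 of the maximum. *)
have rhs_ge0 : 0 <= k%:R + n%:R / (4 * (n%:R - 1)) :> rat.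
  rewrite addr_ge0 ?ler0n //; case: n_cases => [->|n1]; first by rewrite mul0r.
  by rewrite divr_ge0 ?ler0n // mulr_ge0 // subr_ge0 ler1n ltnW.
rewrite /kappa_max; elim/big_ind: _ => // [x y hx hy|D oD].
  by rewrite ge_max hx.
(* For [n = 0] the average is a division by zero, hence 0 by convention. *)
rewrite /avg_kappa hn; case: n_cases => [->|n1].
  by rewrite mul0n invr0 mulr0 mul0r addr0 ler0n.
have := sum_kappa_le (k := k); rewrite -rE => /(_ G D hreg oD).
rewrite hn; set S := (\sum_u _)%N => le_S.
have n0 : (0 : rat) < n%:R by rewrite ltr0n ltnW.
have n10 : (0 : rat) < n%:R - 1 by rewrite subr_gt0 ltr1n.
have predE : (n.-1)%:R = n%:R - 1 :> rat by rewrite -subn1 natrB // ltnW.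
rewrite natrM predE ler_pdivrMr ?mulr_gt0 //.
have -> : (k%:R + n%:R / (4 * (n%:R - 1))) * (n%:R * (n%:R - 1)) =
    k%:R * (n%:R * (n%:R - 1)) + n%:R ^+ 2 / 4 :> rat.
  by field; rewrite gt_eqF.
move: le_S; rewrite -(ler_nat rat) natrD !natrM predE.
by lra.
Qed.
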